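(* Let $s\ge 2$, let $\mathcal{P}=\prod_{i=1}^s\mathcal{E}_i$ with $|\mathcal{E}_i|=e_i>1$, let $G=\mathrm{Sym}(\mathcal{E}_1)\times\cdots\times\mathrm{Sym}(\mathcal{E}_s)$ act coordinatewise on $\mathcal{P}$, let $B\subseteq\mathcal{P}$ be nonempty with $|B|=k$, and let $v=|\mathcal{P}|=\prod_{i\in I}e_i$, where $I=\{1,\dots,s\}$. For $J\subsetneq I$ consider the condition $$(\ast)_J\qquad \sum_{\delta_J\in\mathcal{E}_J}\bigl((\delta_J)\chi_B\bigr)^2 = k+\frac{k(k-1)}{v-1}\left(\Bigl(\prod_{i\in I\setminus J}e_i\Bigr)-1\right).$$ (a) The incidence structure $\mathscr{D}(B,G)$ is a $2$-design if and only if $(\ast)_J$ holds for all $J\subsetneq I$ with $J\neq\varnothing$. (b) Let $H\le G$ be such that $\mathscr{D}(B,H)$ is a $2$-$(v,k,\lambda)$ design. Then: (i) $H$ is transitive on $\mathcal{P}$; (ii) condition $(\ast)_J$ holds for each proper nonempty subset $J$ of $I$; and (iii) $\lambda=\frac{k(k-1)}{v(v-1)}\cdot|H:H_B|$, where $H_B$ is the setwise stabiliser of $B$ in $H$.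
   Context: All sets are finite. The group $G$ acts on $\mathcal{P}$ by $(\delta_1,\dots,\delta_s)^{(g_1,\dots,g_s)}=(\delta_1^{g_1},\dots,\delta_s^{g_s})$. For $J\subseteq I$ put $\mathcal{E}_J=\prod_{i\in J}\mathcal{E}_i$ (with $\mathcal{E}_\varnothing=\{\delta_\varnothing\}$ a singleton), and let $\pi_J:\mathcal{P}\to\mathcal{E}_J$ be the natural projection. For nonempty $B\subseteq\mathcal{P}$, the array function $\chi_B:\bigcup_{J\subsetneq I}\mathcal{E}_J\to\mathbb{N}_{\ge0}$ is given by $(\delta_J)\chi_B=|\{\varepsilon\in B : \varepsilon\pi_J=\delta_J\}|$. For $H\le G$, $\mathscr{D}(B,H)$ is the point-block incidence structure with point set $\mathcal{P}$ and block set $B^H=\{B^g : g\in H\}$. An incidence structure on $v$ points whose blocks form a set of $k$-subsets of the point set is a $2$-design, or $2$-$(v,k,\lambda)$ design, if every pair of distinct points is contained in exactly $\lambda$ blocks, for a constant $\lambda$.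
   Formalization: Part (b)(i), transitivity of H, is stated only for 1 < k < v: for k = 1 or k = v the trivial subgroup H = 1 already gives a 2-design (with λ = 0 or λ = 1) but is not transitive on the point set. *)

(* Defs.v *)
From HB Require Import structures.
From mathcomp Require Import all_boot all_order all_algebra all_fingroup.

Set Implicit Arguments.
Unset Strict Implicit.
Unset Printing Implicit Defensive.

Import GRing.Theory.

(* A point-block incidence structure is given by its point type T and its set
   of blocks Bs; incidence is membership. Repeated blocks are not possible. *)
Definition is_2design (T : finType) (v k lam : nat) (Bs : {set {set T}}) : Prop :=
  [/\ #|T| = v,
      forall b, b \in Bs -> #|b| = k
    & forall x y : T, x != y ->
        #|[set b in Bs | (x \in b) && (y \in b)]| = lam].

(* lam = 0 is allowed. *)
Definition two_design (T : finType) (Bs : {set {set T}}) : Prop :=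
  exists v k lam : nat, is_2design v k lam Bs.

Section Grid.
Variables (s : nat) (E : 'I_s -> finType).

Definition subgrid (J : {set 'I_s}) : finType :=
  {dffun forall i : {i : 'I_s | i \in J}, E (val i)}.

Definition grid : finType := {dffun forall i : 'I_s, E i}.

Definition grid_proj (J : {set 'I_s}) (x : grid) : subgrid J :=
  [ffun i : {i : 'I_s | i \in J} => x (val i)].

Definition array_fun (B : {set grid}) (J : {set 'I_s}) (d : subgrid J) : nat :=
  #|[set x in B | grid_proj J x == d]|.

Definition grid_sym (i : 'I_s) : finGroupType := {perm E i}.

(* The external direct product of the groups Sym(E i). *)
Definition gridG : finGroupType := {dffun forall i : 'I_s, grid_sym i}.

Definition grid_act (x : grid) (g : gridG) : grid :=
  [ffun i : 'I_s => (g i : {perm E i}) (x i)].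


Lemma grid_act_id : grid_act^~ 1%g =1 id.
Proof. by move=> x; apply/ffunP=> i; rewrite !ffunE perm1. Qed.

Lemma grid_actM : forall x, act_morph grid_act x.
Proof. by move=> x g h; apply/ffunP=> i; rewrite !ffunE permM. Qed.

Definition grid_action : {action gridG &-> grid} :=
  TotalAction grid_act_id grid_actM.

(* The block set of D(B, H): all images of B under elements of H. *)
Definition design_blocks (B : {set grid}) (H : {group gridG}) : {set {set grid}} :=
  orbit (grid_action^*)%act H B.

Local Open Scope ring_scope.

(* The right-hand side need not be an integer, so the equation is over rat. *)
Definition array_condition (B : {set grid}) (J : {set 'I_s}) : Prop :=
  let k : rat := #|B|%:R in
  let v : rat := #|grid|%:R in
  (\sum_(d : subgrid J) array_fun B d ^ 2)%N%:R
  = k + k * (k - 1) / (v - 1) * ((\prod_(i in ~: J) #|E i|)%N%:R - 1).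

Lemma card_grid : #|grid| = (\prod_(i < s) #|E i|)%N.
Proof.
rewrite card_dep_ffun foldrE big_map big_enum /=.
by apply: eq_bigr.
Qed.

End Grid.

(* Main.v *)
(** The sum of the squares of the values of [array_fun B J] counts the pairs
    [(x, y)] of points of [B] which agree on [J], so [array_condition B J] says
    that the proportion, among the pairs of distinct points agreeing on [J], of
    those contained in [B] does not depend on [J].  Counting the triples
    [(b, x, y)], with [b] a block containing [x] and [y], yields this for every
    2-design all of whose blocks are images of [B].  Conversely, Moebius inversion
    over [J] gives the same proportion for the pairs agreeing exactly on [A], and
    these form a single orbit of the full group, so every pair of distinct points
    is covered equally often. *)
Require Import Defs.
From mathcomp Require Import all_boot all_order all_algebra all_fingroup.
From mathcomp Require Import ring zify.

Set Implicit Arguments.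
Unset Strict Implicit.
Unset Printing Implicit Defensive.

Import GRing.Theory Num.Theory.

(** * Counting pairs of points against blocks *)

Section DoubleCounting.
Variable T : finType.
Implicit Types (P : pred (T * T)) (x y : T) (b B O : {set T}) (Bs : {set {set T}}).

(** Pairs are ordered, and [pair_count P setT] serves as the total number of pairs satisfying
    [P]. *)
Definition pair_count P b : nat :=
  \sum_(p | P p) ((p.1 \in b) && (p.2 \in b)).

Definition cover_count Bs (p : T * T) : nat :=
  #|[set b in Bs | (p.1 \in b) && (p.2 \in b)]|.

Lemma cover_countE Bs p :
  cover_count Bs p = \sum_(b in Bs) ((p.1 \in b) && (p.2 \in b)).
Proof.
rewrite /cover_count -sum1dep_card big_mkcondr /=.
by apply: eq_bigr => b _; case: (_ && _).
Qed.

Lemma sum_pair_count P Bs :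
  \sum_(b in Bs) pair_count P b = \sum_(p | P p) cover_count Bs p.
Proof.
by rewrite exchange_big; apply: eq_bigr => p _; rewrite cover_countE.
Qed.

Lemma eq_pair_count P Q b : P =1 Q -> pair_count P b = pair_count Q b.
Proof. exact: eq_bigl. Qed.

Lemma sum_const_pairs P (F : T * T -> nat) c :
  (forall p, P p -> F p = c) -> \sum_(p | P p) F p = pair_count P setT * c.
Proof.
move=> Fc; rewrite (eq_bigr (fun=> c)) // big_distrl.
by apply: eq_bigr => p _; rewrite !inE /= mul1n.
Qed.

Lemma pair_count_neq b :
  pair_count (fun p => p.1 != p.2) b = #|b| * #|b|.-1.
Proof.
transitivity (\sum_x \sum_(y | x != y) ((x \in b) && (y \in b))).
  by rewrite pair_big_dep.
rewrite (bigID (fun x => x \in b)) /= [X in _ + X]big1 ?addn0; last first.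
  by move=> x /negPf xb; apply: big1 => y _; rewrite xb.
rewrite -sum_nat_const; apply: eq_bigr => x xb.
rewrite (cardsD1 x b) xb /= -sum1_card [RHS]big_mkcond [LHS]big_mkcond /=.
by apply: eq_bigr => y _; rewrite !inE eq_sym; case: (y == x); case: (y \in b).
Qed.

(** After exchanging the sums, each block through [x] contributes its [m] points of [O]. The term
    [y = x], if present, is the replication number of [x]. *)
Lemma sum_flag_count Bs O m x :
    (forall b, b \in Bs -> #|b :&: O| = m) ->
  \sum_(y in O) cover_count Bs (x, y) = #|[set b in Bs | x \in b]| * m.
Proof.
move=> bO; rewrite (eq_bigr _ (fun y _ => cover_countE Bs (x, y))) exchange_big.
rewrite -sum_nat_const big_mkcond [RHS]big_mkcond /=; apply: eq_bigr => b _.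
rewrite inE; case: ifP => //= Bb; case: (x \in b) => /=; last exact: big1.
rewrite -(bO b Bb) -sum1_card big_mkcond [RHS]big_mkcond /=.
by apply: eq_bigr => y _; rewrite inE; case: (y \in b); case: (y \in O).
Qed.

(** * Block sets that are orbits of a group *)

Variables (gT : finGroupType) (to : {action gT &-> T}).

Lemma mem_setact_act b g x : (to x g \in (to^*)%act b g) = (x \in b).
Proof. by rewrite /= setactE (mem_imset _ _ (act_inj to g)). Qed.

Lemma pair_count_act P b g :
    (forall p, P (to p.1 g, to p.2 g) = P p) ->
  pair_count P ((to^*)%act b g) = pair_count P b.
Proof.
move=> Pg; rewrite /pair_count.
rewrite (reindex (fun p : T * T => (to p.1 g, to p.2 g))) /=.
  by apply: eq_big => [|p _]; rewrite ?Pg // !mem_setact_act.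
exists (fun p => (to p.1 g^-1, to p.2 g^-1)%g) => -[x y] _ /=;
  by rewrite ?actK ?actKV.
Qed.

Lemma sum_pair_count_orbit P B (H : {group gT}) :
    (forall g p, P (to p.1 g, to p.2 g) = P p) ->
  \sum_(p | P p) cover_count (orbit to^* H B) p
    = #|orbit to^* H B| * pair_count P B.
Proof.
move=> Pg; rewrite -sum_pair_count -sum_nat_const.
by apply: eq_bigr => _ /orbitP[g _ <-]; rewrite pair_count_act.
Qed.

Lemma cover_count_act (H : {group gT}) B g p : g \in H ->
  cover_count (orbit to^* H B) (to p.1 g, to p.2 g)
    = cover_count (orbit to^* H B) p.
Proof.
move=> Hg; rewrite /cover_count.
rewrite -[RHS](card_imset _ (act_inj to^* g)).
apply: eq_card => b; rewrite -[b](actKV to^* g).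
rewrite (mem_imset _ _ (act_inj to^* g)).
by rewrite !inE !mem_setact_act orbit_actr.
Qed.

(* If [x] lies in an orbit [O] and [y] does not, counting the incidences of the
   blocks through [x], resp. [y], with [O] forces replication number [lam]. *)
Lemma two_design_transitive (H : {group gT}) B (lam : nat) :
    1 < #|B| < #|T| ->
    (forall x y, x != y -> cover_count (orbit to^* H B) (x, y) = lam) ->
  [transitive H, on [set: T] | to].
Proof.
set Bs := orbit _ _ _ => /andP[k1 kv] Bslam.
pose r x := #|[set b in Bs | x \in b]|.
have rE x : cover_count Bs (x, x) = r x.
  by rewrite /cover_count /r; apply: eq_card => b; rewrite !inE andbb.
(* In [sum_flag_count], a point [y != x] of [O] contributes [lam], and [x] itself contributes
   [r x]. *)
have flag O m x : (forall b, b \in Bs -> #|b :&: O| = m) ->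
    r x * m = (x \in O) * r x + #|O :\ x| * lam.
  move=> /(sum_flag_count x) <-; case: (boolP (x \in O)) => xO.
    rewrite (big_setD1 x) //= rE mul1n -sum_nat_const; congr (_ + _).
    by apply: eq_bigr => y; rewrite !inE eq_sym => /andP[/Bslam].
  rewrite mul0n add0n -sum_nat_const; apply: eq_big => [y|y yO].
    by rewrite !inE; case: eqP => // ->; rewrite (negPf xO).
  by apply: Bslam; apply: contraNneq xO => ->.
have cardBs b : b \in Bs -> #|b :&: setT| = #|B|.
  by rewrite setIT => /orbitP[g _ <-]; rewrite card_setact.
have rk x : r x * #|B| = r x + #|T|.-1 * lam.
  rewrite (flag _ _ _ cardBs) inE mul1n; congr (_ + _ * _).
  by rewrite -cardsT (cardsD1 x setT) inE.
have [x0 x0B] : exists x, x \in B by apply/card_gt0P; apply: ltnW.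
apply/imsetP; exists x0; rewrite ?inE //; apply/esym/eqP.
rewrite -subTset; apply/subsetP => y _; apply/negPn/negP => yO.
set O := orbit _ _ _ in yO; pose m := #|B :&: O|.
(* [O] is invariant under [H], so every image of [B] meets it in equally many points. *)
have BsO b : b \in Bs -> #|b :&: O| = m.
  case/orbitP => g Hg <-; rewrite -[RHS](card_imset _ (act_inj to g)).
  apply: eq_card => x; rewrite -[x](actKV to g).
  rewrite inE mem_setact_act (mem_imset _ _ (act_inj to g)) inE.
  by rewrite orbit_actr.
have x0O : x0 \in O by apply: orbit_refl.
have := flag O m x0 BsO; have := flag O m y BsO.
have -> : O :\ y = O by apply/setDidPl; rewrite disjoint_sym disjoints1.
rewrite x0O (negPf yO) (cardsD1 x0 O) x0O.
have r0 : 0 < r x0 by apply/card_gt0P; exists B; rewrite inE orbit_refl.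
have := rk x0; have := rk y; move: r0 k1 kv.
move: (r x0) (r y) (#|B|) (#|T|) (m) (#|O :\ x0|) => a c k v m' o.
move=> /= r0 k1 kv cE aE cmE amE.
(* By [rk], both [a] and [c] times [k - 1] equal [(v - 1) * lam]. Comparing [cmE] with [amE] then
   gives [a = lam], and [aE] becomes [lam * k = lam * v], against [k < v]. *)
have eac : a = c.
  by apply/eqP; rewrite -(eqn_pmul2r (_ : 0 < k.-1)); [apply/eqP; nia | lia].
have ea : a = lam by rewrite -eac in cmE; lia.
by subst c lam; have/eqP := aE; rewrite -mulSn mulnC eqn_pmul2r //; lia.
Qed.

End DoubleCounting.

(** * Agreement sets, the orbits of the full group on pairs *)

Section Grid.
Variables (s : nat) (E : 'I_s -> finType).
Implicit Types (J A : {set 'I_s}) (B : {set grid E}) (x y : grid E).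
Implicit Types p q : grid E * grid E.

Definition agree p : {set 'I_s} := [set i | p.1 i == p.2 i].

Definition distinct_agree_on J p := (p.1 != p.2) && (J \subset agree p).

Lemma grid_proj_eq J x y :
  (grid_proj J x == grid_proj J y) = (J \subset agree (x, y)).
Proof.
apply/eqP/subsetP => [/ffunP xy i Ji | xy].
  by have := xy (exist _ i Ji); rewrite !ffunE inE /= => ->.
by apply/ffunP => -[i Ji]; rewrite !ffunE; apply/eqP; have := xy i Ji; rewrite inE.
Qed.

Lemma agree_eqT x y : (agree (x, y) == setT) = (x == y).
Proof.
apply/eqP/eqP => [/setP xy | ->]; last by apply/setP => i; rewrite !inE eqxx.
by apply/ffunP => i; have := xy i; rewrite !inE => /eqP.
Qed.

Lemma agree_act p g :
  agree (grid_action E p.1 g, grid_action E p.2 g) = agree p.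
Proof. by apply/setP => i; rewrite !inE !ffunE (inj_eq perm_inj). Qed.

(** Coordinates can be treated separately: a permutation taking [x i] to [z i] and [y i] to [t i]
    exists as soon as [x i = y i] exactly when [z i = t i]. *)
Lemma agree_transitive p q : agree p = agree q ->
  exists g, (grid_action E p.1 g, grid_action E p.2 g) = q.
Proof.
case: p q => [x y] [z t] /setP pq.
(* The first transposition takes [x i] to [z i]; the second takes the image of [y i] to [t i] and
   fixes [z i]. *)
pose f i := (tperm (x i) (z i) * tperm (tperm (x i) (z i) (y i)) (t i))%g.
exists [ffun i => f i : grid_sym E i].
congr (_, _); apply/ffunP => i; rewrite !ffunE permM ?tpermL //.
have := pq i; rewrite !inE /= => xyzt.
case: (eqVneq (x i) (y i)) xyzt => [<- | xy] /esym => [/eqP <- | zt].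
  by rewrite tpermL tperm1 perm1.
rewrite tpermD 1?eq_sym ?zt //.
by rewrite -[X in X != _](tpermL (x i) (z i)) (inj_eq perm_inj).
Qed.

(** * The array condition as a statement on pairs *)

Lemma sum_array_fun_sqr J B :
  \sum_(d : subgrid E J) array_fun B d ^ 2
    = \sum_(x in B) array_fun B (grid_proj J x).
Proof.
rewrite [RHS](partition_big (grid_proj J) xpredT) //; apply: eq_bigr => d _.
rewrite (eq_bigr (fun=> array_fun B d)) => [|x /andP[_ /eqP->] //].
rewrite sum_nat_const -mulnn; congr (_ * _).
by rewrite /array_fun; apply: eq_card => x; rewrite inE.
Qed.

Lemma array_fun_pair_count J B :
  \sum_(d : subgrid E J) array_fun B d ^ 2
    = #|B| + pair_count (distinct_agree_on J) B.
Proof.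
rewrite sum_array_fun_sqr.
have -> : pair_count (distinct_agree_on J) B = \sum_x \sum_(y |
    distinct_agree_on J (x, y)) ((x \in B) && (y \in B)).
  by rewrite pair_big_dep; apply: eq_bigl => -[].
rewrite [X in _ = _ + X](bigID (fun x => x \in B)) /=.
rewrite [X in _ = _ + (_ + X)]big1 ?addn0; last first.
  by move=> x /negPf xB; apply: big1 => y _; rewrite xB.
rewrite -sum1_card -big_split; apply: eq_bigr => x xB.
rewrite /array_fun (cardsD1 x) inE xB eqxx; congr (_ + _).
rewrite -sum1_card big_mkcond [RHS]big_mkcond; apply: eq_bigr => y _ /=.
rewrite !inE /distinct_agree_on /= eq_sym [_ == grid_proj _ _]eq_sym.
by rewrite grid_proj_eq; case: (_ == _); case: (_ \in _); case: (_ \subset _).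
Qed.

Lemma array_fun_setT J x :
  array_fun setT (grid_proj J x) = \prod_(i in ~: J) #|E i|.
Proof.
(* The fibre through [x] is a product: one value at each coordinate in [J], all values elsewhere. *)
pose F i : pred (E i) := fun a => (i \in J) ==> (a == x i).
transitivity #|(family F : simpl_pred {dffun forall i, E i})|.
  apply: eq_card => y; rewrite !inE /= grid_proj_eq.
  apply/subsetP/forallP => xy i; first by apply/implyP => /xy; rewrite inE.
  by move=> Ji; rewrite inE; have/implyP := xy i; apply.
rewrite card_family foldrE big_map big_enum /= [RHS]big_mkcond /=.
apply: eq_bigr => i _; rewrite inE -(card1 (x i)) /F.
by case: (i \in J); apply: eq_card => a; rewrite !inE.
Qed.

(** This interprets the last factor of [array_condition]: times [v], it is the number of pairs of
    distinct points agreeing on [J]. *)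
Lemma pair_count_setT J :
  #|grid E| + pair_count (distinct_agree_on J) setT
    = #|grid E| * \prod_(i in ~: J) #|E i|.
Proof.
rewrite -[X in X + _]cardsT -array_fun_pair_count sum_array_fun_sqr.
by rewrite (eq_bigr _ (fun x _ => array_fun_setT J x)) sum_nat_const cardsT.
Qed.

(** Substituting [pair_count_setT] and clearing denominators turns the condition into an equality of
    proportions over the natural numbers. *)
Lemma array_conditionP J B : 1 < #|grid E| -> B != set0 ->
  array_condition B J <->
  pair_count (distinct_agree_on J) B * (#|grid E| * #|grid E|.-1)
    = #|B| * #|B|.-1 * pair_count (distinct_agree_on J) setT.
Proof.
rewrite -card_gt0 /array_condition array_fun_pair_count => v1 k0.
have := pair_count_setT J.
move: (pair_count _ B) (pair_count _ setT) (\prod_(_ in _) _) => n m w.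
case: #|grid E| v1 => [//|[//|v]] _; case: #|B| k0 => [//|k] _ /= mE.
have {}mE : (m%:R = (v.+2)%:R * (w%:R - 1) :> rat)%R.
  by apply/eqP; rewrite mulrBr mulr1 eq_sym subr_eq -natrM -mE natrD addrC.
have v0 : (v.+1%:R != 0 :> rat)%R by rewrite pnatr_eq0.
have v20 : (v.+2%:R != 0 :> rat)%R by rewrite pnatr_eq0.
have -> : (v.+2%:R - 1 = v.+1%:R :> rat)%R by rewrite -(natr1 v.+1) addrK.
have -> : (k.+1%:R - 1 = k%:R :> rat)%R by rewrite -(natr1 k) addrK.
rewrite natrD; split => [/addrI nE | /(congr1 (fun a => a%:R : rat)%R)].
  apply/eqP; rewrite -(eqr_nat rat) !natrM mE nE; apply/eqP; field.
  by rewrite addrC natr1.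
rewrite !natrM mE => /= nE; congr (_ + _)%R.
apply: (mulIf v0); apply: (mulIf v20); rewrite -mulrA [X in (_ * X)%R]mulrC nE.
by field; rewrite addrC natr1.
Qed.

(** This is the sum over supersets to be inverted; excluding [setT] encodes distinctness of the two
    points. *)
Lemma pair_count_distinct_agree_on J b :
  pair_count (distinct_agree_on J) b
    = \sum_(A | (A != setT) && (J \subset A))
        pair_count (fun p => agree p == A) b.
Proof.
rewrite /pair_count (partition_big agree
  (fun A => (A != setT) && (J \subset A))) /=; last first.
  by move=> [x y]; rewrite /distinct_agree_on agree_eqT.
apply: eq_bigr => A /andP[AT JA]; apply: eq_bigl => -[x y].
rewrite /distinct_agree_on /= -agree_eqT.
by case: (_ =P A) => [->|_]; rewrite ?andbF // AT JA.
Qed.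

Lemma distinct_agree_on0 p : distinct_agree_on set0 p = (p.1 != p.2).
Proof. by rewrite /distinct_agree_on sub0set andbT. Qed.

Lemma distinct_agree_on_act J p g :
  distinct_agree_on J (grid_action E p.1 g, grid_action E p.2 g)
    = distinct_agree_on J p.
Proof. by rewrite /distinct_agree_on agree_act (inj_eq (act_inj _ g)). Qed.

Lemma card_grid_gt1 : 0 < s -> (forall i, 1 < #|E i|) -> 1 < #|grid E|.
Proof.
case: s E => // n F _ F1; rewrite card_grid big_ord_recl.
rewrite (leq_trans (F1 ord0)) // leq_pmulr // prodn_gt0 // => i.
exact: ltnW (F1 _).
Qed.

(** * The array condition and 2-designs, in both directions *)

Section TwoDesign.
Variables (B : {set grid E}) (H : {group gridG E}) (lam : nat).
Let Bs := design_blocks B H.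
Hypothesis Bs_lam : forall x y, x != y -> cover_count Bs (x, y) = lam.

Lemma two_design_pair_count J :
  #|Bs| * pair_count (distinct_agree_on J) B
    = pair_count (distinct_agree_on J) setT * lam.
Proof.
rewrite -sum_pair_count_orbit; last by move=> g p; apply: distinct_agree_on_act.
by apply: sum_const_pairs => -[x y] /andP[/Bs_lam].
Qed.

Lemma two_design_parameters :
  #|Bs| * (#|B| * #|B|.-1) = #|grid E| * #|grid E|.-1 * lam.
Proof.
rewrite -cardsT -!pair_count_neq -!(eq_pair_count _ distinct_agree_on0).
exact: two_design_pair_count.
Qed.

Lemma two_design_array_condition J :
  1 < #|grid E| -> B != set0 -> array_condition B J.
Proof.
move=> v1 B0; apply/(array_conditionP _ v1 B0).
have Bs0 : 0 < #|Bs| by apply/card_gt0P; exists B; apply: orbit_refl.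
(* After multiplication by the number of blocks, the counts for [J] and for [set0] turn both sides
   into the same product with [lam]. *)
apply/eqP; rewrite -(eqn_pmul2l Bs0) !mulnA two_design_pair_count.
by rewrite -[#|Bs| * _ * _]mulnA two_design_parameters; apply/eqP; ring.
Qed.

End TwoDesign.

(* Downward induction on [A]: the pairs agreeing on [A] but nowhere else are those
   agreeing on [A], minus those whose agreement set is strictly larger. *)
Lemma array_condition_exact B :
    1 < #|grid E| -> B != set0 ->
    (forall J, J \proper setT -> J != set0 -> array_condition B J) ->
  forall A, A != setT ->
    pair_count (fun p => agree p == A) B * (#|grid E| * #|grid E|.-1)
      = #|B| * #|B|.-1 * pair_count (fun p => agree p == A) setT.
Proof.
move=> v1 B0 arrB.
have {}arrB J : J != setT ->
    pair_count (distinct_agree_on J) B * (#|grid E| * #|grid E|.-1)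
      = #|B| * #|B|.-1 * pair_count (distinct_agree_on J) setT.
  (* For [J = set0] the equality is an identity: all pairs of distinct points qualify. *)
  move=> JT; have [->|J0] := eqVneq J set0.
    by rewrite !(eq_pair_count _ distinct_agree_on0) !pair_count_neq cardsT.
  by apply/array_conditionP => //; apply: arrB; rewrite // properT.
move=> A; have [n] := ubnP #|~: A|; elim: n A => // n IHn A ltAn AT.
have := arrB A AT; rewrite !pair_count_distinct_agree_on.
rewrite big_distrl big_distrr /=.
rewrite (bigD1 A) ?AT ?subxx //= [RHS](bigD1 A) ?AT ?subxx //=.
set u := (X in _ + X = _); set w := (X in _ = _ + X).
suff -> : u = w by move/addIn.
apply: eq_bigr => C /andP[/andP[CT AC] CA]; apply: IHn => //.
apply: leq_trans (_ : #|~: A| <= n); last by [].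
by apply: proper_card; rewrite properC properEneq eq_sym CA.
Qed.

(** The cover count is constant on the pairs with the agreement set of [p], so counting triples over
    these pairs determines it; [array_condition_exact] makes the outcome independent of that set. *)
Lemma cover_count_full_group B p :
    1 < #|grid E| -> B != set0 ->
    (forall J, J \proper setT -> J != set0 -> array_condition B J) ->
    p.1 != p.2 ->
  cover_count (design_blocks B [set: gridG E]) p * (#|grid E| * #|grid E|.-1)
    = #|design_blocks B [set: gridG E]| * (#|B| * #|B|.-1).
Proof.
move=> v1 B0 arrB; case: p => x y neq_xy.
set Bs := design_blocks _ _; set A := agree (x, y).
have AT : A != setT by rewrite agree_eqT.
pose P (q : grid E * grid E) := agree q == A.
have PT0 : 0 < pair_count P setT.
  by rewrite /pair_count (bigD1 (x, y)) ?inE // /P.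
have BsP : #|Bs| * pair_count P B = pair_count P setT * cover_count Bs (x, y).
  rewrite -(sum_pair_count_orbit (to := grid_action E)); last first.
    by move=> g q; rewrite /P agree_act.
  apply: sum_const_pairs => q /eqP/esym/agree_transitive[g <-].
  by rewrite cover_count_act ?inE.
apply/eqP; rewrite -(eqn_pmul2l PT0) mulnA -BsP -mulnA.
by rewrite array_condition_exact //; apply/eqP; rewrite -/P; ring.
Qed.

End Grid.

Theorem theorem1p3 (s : nat) (E : 'I_s -> finType) (B : {set grid E})
    (v k : nat) :
  (2 <= s)%N ->
  (forall i : 'I_s, (1 < #|E i|)%N) ->
  B != set0 ->
  #|B| = k ->
  #|grid E| = v ->
  (two_design (design_blocks B [set: gridG E]%G)
   <-> (forall J : {set 'I_s},
          J \proper [set: 'I_s] -> J != set0 -> array_condition B J))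
  /\
  (forall (H : {group gridG E}) (lam : nat),
     is_2design v k lam (design_blocks B H) ->
     [/\ (* a design with k = 1 or k = v says nothing about transitivity *)
         (1 < k)%N -> (k < v)%N ->
           [transitive H, on [set: grid E] | grid_action E],
         forall J : {set 'I_s},
           J \proper [set: 'I_s] -> J != set0 -> array_condition B J
       & (lam%:R = (k%:R * (k%:R - 1)) / (v%:R * (v%:R - 1))
                   * #|H : 'N_H(B | grid_action E)|%g%:R :> rat)%R]).
Proof.
move=> s2 E1 B0 cardB cardv.
have v1 : 1 < #|grid E| by apply: card_grid_gt1; first exact: ltnW.
split; last first.
  move=> H lam [_ _ Bs_lam]; split=> [k1 kv|J _ _|].
  - by apply: two_design_transitive Bs_lam; rewrite cardB cardv k1.
  - exact: two_design_array_condition Bs_lam J v1 B0.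
  (* Orbit-stabiliser: the number of blocks is the index of the setwise stabiliser. *)
  have := two_design_parameters Bs_lam; rewrite /design_blocks card_orbit astab1_set.
  rewrite cardB cardv; move: #|_ : _|%g => m.
  rewrite -card_gt0 cardB in B0; rewrite cardv in v1.
  (* With [k] and [v] written as successors, [.-1] matches subtraction in [rat]. *)
  case: k B0 {cardB} => // k _; case: v v1 {cardv} => [//|[//|v]] _ /=.
  move/(congr1 (fun a => a%:R : rat)%R); rewrite /= !natrM.
  have -> : (v.+2%:R - 1 = v.+1%:R :> rat)%R by rewrite -(natr1 v.+1) addrK.
  have -> : (k.+1%:R - 1 = k%:R :> rat)%R by rewrite -(natr1 k) addrK.
  have v0 : (v.+2%:R * v.+1%:R != 0 :> rat)%R by rewrite mulf_neq0 ?pnatr_eq0.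
  move=> mE; apply: (mulfI v0); rewrite -mE [RHS]mulrC [RHS]mulrAC divfK //.
  exact: mulrC.
split=> [[v' [k' [lam [_ _ Bs_lam]]]] J _ _ | arrB].
  exact: two_design_array_condition Bs_lam J v1 B0.
have cover := cover_count_full_group v1 B0 arrB.
have [x [y [_ _ neq_xy]]] : exists x y, [/\ x \in grid E, y \in grid E & x != y].
  exact/card_gt1P.
(* Any pair of distinct points supplies the constant, since [cover] has a right-hand side free of
   the pair. *)
exists v, k, (cover_count (design_blocks B [set: gridG E]) (x, y)); split=> //.
  by move=> _ /orbitP[g _ <-]; rewrite card_setact.
move=> z t neq_zt; apply/eqP.
rewrite -(eqn_pmul2r (_ : 0 < #|grid E| * #|grid E|.-1)); last first.
  by rewrite muln_gt0 -subn1 subn_gt0 v1 ltnW.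
by rewrite (cover (x, y)) // -(cover (z, t)).
Qed.
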